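(* Let $n\ge0$ and let $G$ be a TDLC-group of type $\mathrm{FP}_\infty$ with $\mathrm{cd}_{\mathbb{Q}}(G)=n+1$ that satisfies the weak $n$-dimensional linear isoperimetric inequality. Then every closed subgroup $H$ of $G$ of type $\mathrm{FP}_{n+1}$ satisfies the weak $n$-dimensional linear isoperimetric inequality.
   Context: A TDLC-group is a totally disconnected locally compact Hausdorff topological group; closed subgroups of TDLC-groups are TDLC-groups. For a TDLC-group $G$: a discrete $\mathbb{Q}[G]$-module is a left $\mathbb{Q}[G]$-module in which every element has open stabilizer; they form an abelian category ${}_{\mathbb{Q}[G]}\mathrm{dis}$ with enough projectives, and $\mathrm{cd}_{\mathbb{Q}}(G)$ is the minimal length of a projective resolution of the trivial module $\mathbb{Q}$ in it. A $G$-set $\Omega$ is proper if all point stabilizers are compact open; $\mathbb{Q}[\Omega]$ is then a proper permutation module, finitely generated iff $\Omega/G$ is finite, with $\ell_1$-norm $\|\sum a_\omega\omega\|_1=\sum|a_\omega|$. $G$ has type $\mathrm{FP}_n$ if there is an exact sequence $\mathbb{Q}[\Omega_n]\to\cdots\to\mathbb{Q}[\Omega_0]\to\mathbb{Q}\to0$ in ${}_{\mathbb{Q}[G]}\mathrm{dis}$ with each $\Omega_i$ a proper $G$-set with finitely many orbits (a partial proper permutation resolution of finite type); type $\mathrm{FP}_\infty$ means type $\mathrm{FP}_n$ for all $n$. $G$ of type $\mathrm{FP}_{n+1}$ satisfies the weak $n$-dimensional linear isoperimetric inequality if for some (equivalently any) such resolution $\mathbb{Q}[\Omega_{n+1}]\xrightarrow{\delta_{n+1}}\mathbb{Q}[\Omega_n]\xrightarrow{\delta_n}\cdots\to\mathbb{Q}[\Omega_0]\to\mathbb{Q}\to0$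 there is $C>0$ with $\inf\{\|y\|_1: y\in\mathbb{Q}[\Omega_{n+1}],\ \delta_{n+1}(y)=x\}\le C\|x\|_1$ for all $x\in\ker\delta_n$. *)

(* Defs.v *)
From HB Require Import structures.
From mathcomp Require Import all_boot all_order all_algebra.
From mathcomp Require Import boolp classical_sets topology.
From mathcomp Require Import freeg.

Set Implicit Arguments.
Unset Strict Implicit.
Unset Printing Implicit Defensive.

Import Order.TTheory GRing.Theory Num.Theory.
Local Open Scope classical_set_scope.
Local Open Scope ring_scope.

Record tgroup := TGroup {
  tg_car :> topologicalType;
  tg_mul : tg_car -> tg_car -> tg_car;
  tg_inv : tg_car -> tg_car;
  tg_one : tg_car }.

Arguments tg_mul {t}.
Arguments tg_inv {t}.
Arguments tg_one {t}.

Definition group_laws (G : tgroup) : Prop :=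
  [/\ forall x y z : G, tg_mul x (tg_mul y z) = tg_mul (tg_mul x y) z,
      forall x : G, tg_mul tg_one x = x /\ tg_mul x tg_one = x &
      forall x : G, tg_mul (tg_inv x) x = tg_one /\ tg_mul x (tg_inv x) = tg_one].

Definition TDLC (G : tgroup) : Prop :=
  [/\ group_laws G,
      continuous (fun p : G * G => tg_mul p.1 p.2),
      continuous (@tg_inv G) &
      [/\ hausdorff_space G,
      locally_compact [set: G] &
      totally_disconnected [set: G]]].

Definition closed_subgroup (G : tgroup) (H : set G) : Prop :=
  [/\ closed H, H tg_one,
      forall x y, H x -> H y -> H (tg_mul x y) &
      forall x, H x -> H (tg_inv x)].

Definition open_in (G : tgroup) (H U : set G) : Prop :=
  exists V : set G, open V /\ U = V `&` H.

(* compact open subset of H (compactness in H = compactness in G) *)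
Definition compact_open_in (G : tgroup) (H K : set G) : Prop :=
  [/\ K `<=` H, compact K & open_in H K].

(* Discrete Q[H]-modules (H a closed subgroup of G; H = [set: G] gives G)  *)

Definition dmod_axioms (G : tgroup) (H : set G) (M : lmodType rat)
    (act : G -> M -> M) : Prop :=
  [/\ forall h, H h -> forall x y, act h (x + y) = act h x + act h y,
      forall h, H h -> forall (c : rat) x, act h (c *: x) = c *: act h x,
      forall x, act tg_one x = x,
      forall g h, H g -> H h -> forall x, act (tg_mul g h) x = act g (act h x) &
      forall x, open_in H [set h | H h /\ act h x = x]].

Record dmod (G : tgroup) (H : set G) := DMod {
  dm_car :> lmodType rat;
  dm_act : G -> dm_car -> dm_car;
  dm_ax : dmod_axioms H dm_act }.

Arguments dm_act {G H} d : rename.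

Definition dhom (G : tgroup) (H : set G) (M N : dmod H) (f : M -> N) : Prop :=
  [/\ forall x y, f (x + y) = f x + f y,
      forall (c : rat) x, f (c *: x) = c *: f x &
      forall h, H h -> forall x, f (dm_act M h x) = dm_act N h (f x)].

Definition dprojective (G : tgroup) (H : set G) (P : dmod H) : Prop :=
  forall (M N : dmod H) (p : M -> N) (f : P -> N),
    dhom p -> dhom f -> (forall y, exists x, p x = y) ->
    exists g : P -> M, dhom g /\ forall x, p (g x) = f x.

Lemma triv_dmod_axioms (G : tgroup) (H : set G) :
  @dmod_axioms G H rat^o (fun _ x => x).
Proof.
split=> // x; exists setT; split; first exact: openT.
by rewrite setTI; apply/seteqP; split=> h /=; [case|].
Qed.

Definition triv_dmod (G : tgroup) (H : set G) : dmod H :=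
  DMod (triv_dmod_axioms H).

Definition has_proj_resolution (G : tgroup) (H : set G) (n : nat) : Prop :=
  exists (P : nat -> dmod H) (d : forall i, P i.+1 -> P i)
         (aug : P 0%N -> triv_dmod H),
  [/\ forall i, dprojective (P i),
      forall i, dhom (d i),
      dhom aug &
      [/\
      forall i, (n < i)%N -> forall x : P i, x = 0,
      forall y, exists x, aug x = y,
      forall x, aug x = 0 <-> exists y, d 0%N y = x &
      forall i (x : P i.+1), d i x = 0 <-> exists y, d i.+1 y = x]].

Definition cdQ_eq (G : tgroup) (H : set G) (k : nat) : Prop :=
  has_proj_resolution H k /\ forall m, (m < k)%N -> ~ has_proj_resolution H m.

Record hset (G : tgroup) (H : set G) := HSet {
  hs_car :> choiceType;
  hs_act : G -> hs_car -> hs_car }.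

Arguments hs_act {G H} h : rename.

Definition proper_fin_hset (G : tgroup) (H : set G) (O : hset H) : Prop :=
  [/\ forall w : O, hs_act O tg_one w = w,
      forall g h, H g -> H h -> forall w, hs_act O (tg_mul g h) w = hs_act O g (hs_act O h w),
      forall w, compact_open_in H [set h | H h /\ hs_act O h w = w] &
      exists s : seq O, forall w : O, exists2 w0, w0 \in s &
        exists h, H h /\ w = hs_act O h w0].

Definition QP (G : tgroup) (H : set G) (O : hset H) := {freeg O / rat}.

Definition QP_act (G : tgroup) (H : set G) (O : hset H) (h : G) (x : QP O) : QP O :=
  fglift (fun w : O => (<< hs_act O h w >> : {freeg O / rat})) x.

Definition norm1 (G : tgroup) (H : set G) (O : hset H) (x : QP O) : rat :=
  \sum_(w <- dom x) `|coeff w x|.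

Definition phom (G : tgroup) (H : set G) (O1 O2 : hset H) (f : QP O1 -> QP O2) : Prop :=
  [/\ forall x y, f (x + y) = f x + f y,
      forall (c : rat) x, f (c *: x) = c *: f x &
      forall h, H h -> forall x, f (QP_act h x) = QP_act h (f x)].

Definition aug_hom (G : tgroup) (H : set G) (O : hset H) (f : QP O -> rat) : Prop :=
  [/\ forall x y, f (x + y) = f x + f y,
      forall (c : rat) x, f (c *: x) = c * f x &
      forall h, H h -> forall x, f (QP_act h x) = f x].

(* kernel of delta_i, where delta_0 is the augmentation to Q *)
Definition dker (G : tgroup) (H : set G) (Om : nat -> hset H)
    (d : forall i, QP (Om i.+1) -> QP (Om i)) (e : QP (Om 0%N) -> rat) :
    forall i, QP (Om i) -> Prop :=
  fun i => match i as k return QP (Om k) -> Prop with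
           | 0%N => fun x => e x = 0
           | k.+1 => fun x => d k x = 0
           end.

Definition perm_resolution (G : tgroup) (H : set G) (m : nat) (Om : nat -> hset H)
    (d : forall i, QP (Om i.+1) -> QP (Om i)) (e : QP (Om 0%N) -> rat) : Prop :=
  [/\ forall i, (i <= m)%N -> proper_fin_hset (Om i),
      forall i, (i < m)%N -> phom (d i),
      aug_hom e,
      forall y, exists x, e x = y &
      forall i, (i < m)%N -> forall x : QP (Om i),
        dker d e x <-> exists y, d i y = x].

Definition type_FP (G : tgroup) (H : set G) (m : nat) : Prop :=
  exists Om d e, @perm_resolution G H m Om d e.

Definition type_FPinf (G : tgroup) (H : set G) : Prop :=
  forall m, type_FP H m.

(* weak n-dimensional linear isoperimetric inequality:
   inf { |y|_1 : delta_{n+1} y = x } <= C |x|_1 for x in ker delta_n,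
   written with the infimum unfolded (all norms are rational). *)
Definition weak_lin_isoperimetric (G : tgroup) (H : set G) (n : nat) : Prop :=
  exists Om d e, @perm_resolution G H n.+1 Om d e /\
    exists C : rat, 0 < C /\
      forall x : QP (Om n), dker d e x ->
        forall eps : rat, 0 < eps ->
          exists y : QP (Om n.+1), d n y = x /\ norm1 y <= C * norm1 x + eps.

(* Main.v *)
Require Import Defs.
From HB Require Import structures.
From mathcomp Require Import all_boot all_order all_algebra.
From mathcomp Require Import boolp classical_sets cardinality topology.
From mathcomp Require Import freeg.

Set Implicit Arguments.
Unset Strict Implicit.
Unset Printing Implicit Defensive.

Import Order.TTheory GRing.Theory Num.Theory.
Local Open Scope classical_set_scope.
Local Open Scope ring_scope.

(** Let [Q[Om]] and [Q[La]] be the given resolutions for [G] and for [H]. Proper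
permutation modules have the lifting property, by averaging over compact
stabilizers, and this survives restriction to [H]. Comparing [Q[Om]] with a
projective resolution of length [n+1] splits [d_(n+1)] over its image: there is an
equivariant endomorphism [tau] of [Q[Om_(n+1)]] with [d tau = d] that vanishes on
the kernel of [d], and the isoperimetric inequality gives [|tau y| <= C |d y|].
Comparing [Q[La]] with [Q[Om]] over [H] gives chain maps [a], [b] and a homotopy
[s] from the identity to [b a], and [b tau a - s d] splits [d_(n+1)] for [H] in the
same sense. Since [La] has finitely many orbits, [a] and [s] are bounded. The map
[b] need not be, but all [tau (a y)] are supported on finitely many [H]-orbits, and
there [b] is bounded; so [|b (tau (a y)) - s (d y)| <= C' |d y|]. *)

Section LinearOf.
Variables (R : pzRingType) (M N : lmodType R) (f : M -> N).

(* A truncated resolution has linear differentials only below the truncation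
   degree; the remaining ones are replaced by [0]. *)
Definition linear_of : {linear M -> N} :=
  if pselect (linear f) is left f_linear then
    HB.pack f (GRing.isLinear.Build R M N *:%R f f_linear)
  else \0.

Lemma linear_ofE : linear f -> linear_of = f :> (M -> N).
Proof. by rewrite /linear_of; case: pselect. Qed.

Lemma additive_scalable_linear :
  (forall x y, f (x + y) = f x + f y) -> (forall c x, f (c *: x) = c *: f x) ->
  linear f.
Proof. by move=> fD fZ c x y; rewrite fD fZ. Qed.

End LinearOf.

Definition subgroup (G : tgroup) (H : set G) : Prop :=
  [/\ H tg_one, forall g h, H g -> H h -> H (tg_mul g h) &
      forall h, H h -> H (tg_inv h)].

(* The action is constrained only over a given subgroup, see [discrete]: one module
   is viewed both over [G] and over its closed subgroups. *)
Record premod (G : tgroup) := PreMod {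
  pm_car :> lmodType rat;
  pm_act : G -> pm_car -> pm_car }.

Arguments pm_act {G} p : rename.

Section Modules.
Variables (G : tgroup) (H : set G).
Implicit Types M N P : premod G.

Definition discrete M : Prop := dmod_axioms H (pm_act M).

Definition equivariant M N (f : M -> N) : Prop :=
  forall h, H h -> forall x, f (pm_act M h x) = pm_act N h (f x).

Definition lifting_property P : Prop :=
  forall M N (p : {linear M -> N}) (f : {linear P -> N}),
    discrete M -> discrete N -> equivariant p -> equivariant f ->
    (forall x, exists y, p y = f x) ->
    exists2 g : {linear P -> M}, equivariant g & forall x, p (g x) = f x.

Lemma act_linear M h : discrete M -> H h -> linear (pm_act M h).
Proof.
by case=> aD aZ _ _ _ Hh; apply: additive_scalable_linear; [apply: aD|apply: aZ].
Qed.

Lemma equivariant_id M : equivariant (@idfun M).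
Proof. by []. Qed.

Lemma equivariant_comp M N P (f : N -> P) (g : M -> N) :
  equivariant f -> equivariant g -> equivariant (f \o g).
Proof. by move=> fH gH h Hh x /=; rewrite gH // fH. Qed.

Lemma equivariantB M N (f g : M -> N) :
  discrete N -> equivariant f -> equivariant g -> equivariant (f \- g).
Proof.
move=> discN fH gH h Hh x /=; have actN := linear_ofE (act_linear discN Hh).
by rewrite fH // gH // -actN -linearB.
Qed.

Lemma equivariant0 M N : discrete N -> equivariant (\0 : M -> N).
Proof.
by move=> discN h Hh x /=; rewrite -(linear_ofE (act_linear discN Hh)) linear0.
Qed.

End Modules.

Lemma equivariantS (G : tgroup) (H H' : set G) (M N : premod G) (f : M -> N) :
  H' `<=` H -> equivariant H f -> equivariant H' f.
Proof. by move=> sH'H fH h /sH'H; apply: fH. Qed.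

Lemma dependent_family_choice (X : nat -> Type)
    (R : forall k, X k -> X k.+1 -> Prop) (x0 : X 0%N) :
  (forall k x, exists y, R k x y) ->
  exists f : forall k, X k, f 0%N = x0 /\ forall k, R k (f k) (f k.+1).
Proof.
move=> extend; exists (nat_rect X x0 (fun k x => sval (cid (extend k x)))).
by split=> // k; apply: svalP.
Qed.

Definition aug_mod (G : tgroup) (N : premod G) (A : nat -> premod G) k : premod G :=
  if k is j.+1 then A j else N.

Definition aug_diff (G : tgroup) (N : premod G) (A : nat -> premod G)
    (d : forall i, A i.+1 -> A i) (e : A 0%N -> N) k :
    {linear aug_mod N A k.+1 -> aug_mod N A k} :=
  match k return {linear aug_mod N A k.+1 -> aug_mod N A k} with
  | 0%N => linear_of e
  | j.+1 => linear_of (d j)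
  end.

Section Resolutions.
Variables (G : tgroup) (H : set G).

Definition cycles (A : nat -> premod G) (d : forall k, {linear A k.+1 -> A k}) k :
    A k -> Prop :=
  match k with 0%N => fun=> True | j.+1 => fun x => d j x = 0 end.

(* [A 0] is the resolved module and [d 0] the augmentation; nothing is assumed
   beyond [d m]. *)
Definition resolution (A : nat -> premod G) (d : forall k, {linear A k.+1 -> A k}) m :=
  [/\ forall k, (k <= m.+1)%N -> discrete H (A k),
      forall k, (k <= m)%N -> lifting_property H (A k.+1),
      forall k, (k <= m)%N -> equivariant H (d k) &
      forall k, (k <= m)%N -> forall x, cycles d x <-> exists y, d k y = x].

Definition chain_map (A B : nat -> premod G) (dA : forall k, {linear A k.+1 -> A k})
    (dB : forall k, {linear B k.+1 -> B k}) m (f : forall k, {linear A k -> B k}) :=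
  (forall k, (k <= m.+1)%N -> equivariant H (f k)) /\
  forall k, (k <= m)%N -> forall x, dB k (f k.+1 x) = f k (dA k x).

Section TwoResolutions.
Variables (A B : nat -> premod G).
Variables (dA : forall k, {linear A k.+1 -> A k}) (dB : forall k, {linear B k.+1 -> B k}).
Variable m : nat.
Hypotheses (resA : resolution dA m) (resB : resolution dB m).

Lemma chain_map_lift (f0 : {linear A 0%N -> B 0%N}) :
  equivariant H f0 -> exists2 f, chain_map dA dB m f & f 0%N = f0.
Proof.
have [discA liftA dAH exA] := resA; have [discB _ dBH exB] := resB.
move=> f0H; pose cycle_hom k (f : {linear A k -> B k}) :=
  equivariant H f /\ forall x, cycles dA x -> cycles dB (f x).
pose extends k (f : {linear A k -> B k}) (g : {linear A k.+1 -> B k.+1}) :=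
  (k <= m)%N -> cycle_hom k f ->
  equivariant H g /\ forall x, dB k (g x) = f (dA k x).
have [k f|f [ff0 fS]] := @dependent_family_choice _ extends f0.
  have [[km [fH fcyc]]|] := pselect ((k <= m)%N /\ cycle_hom k f); last first.
    by move=> bad; exists \0 => km f_hom; case: bad.
  have [||||x|g gH dg] := liftA k km _ _ (dB k) (f \o dA k).
  - by apply: discB; rewrite ltnS.
  - by apply: discB; rewrite leqW.
  - exact: dBH.
  - by apply: equivariant_comp fH _; apply: dAH.
  - by apply/exB => //; apply/fcyc/exA => //; exists x.
  by exists g.
have f_hom k : (k <= m.+1)%N -> cycle_hom k (f k).
  elim: k => [_|k IH km]; first by rewrite ff0.
  have [fH df] := fS k km (IH (ltnW km)).
  by split=> // x /= dx0; rewrite df dx0 linear0.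
exists f => //; split=> k km; first by case: (f_hom k km).
by case: (fS k km (f_hom k (leqW km))).
Qed.

Lemma chain_homotopy f g :
  chain_map dA dB m f -> chain_map dA dB m g -> f 0%N =1 g 0%N ->
  forall k, (k <= m)%N -> exists2 s : {linear A k -> B k.+1}, equivariant H s &
    forall x, cycles dA x -> dB k (s x) = f k x - g k x.
Proof.
have [discA liftA dAH exA] := resA; have [discB _ dBH exB] := resB.
move=> [fH df] [gH dg] fg0; elim=> [_|k IH km].
  exists \0; first exact/equivariant0/discB.
  by move=> x _; rewrite linear0 fg0 subrr.
have km1 := ltnW km; have [s sH ds] := IH km1.
pose r : {linear A k.+1 -> B k.+1} := (f k.+1 \- g k.+1) \- (s \o dA k).
have [||||x|s' s'H ds'] := liftA k km1 _ _ (dB k.+1) r.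
- exact: discB.
- by apply: discB; rewrite ltnS.
- exact: dBH.
- have discBk := discB k.+1 km1; apply: equivariantB => //.
    by apply: equivariantB => //; [apply: fH|apply: gH].
  by apply: equivariant_comp sH _; apply: dAH.
- apply/exB => //=; rewrite !linearB /= df // dg // ds ?subrr //.
  by apply/exA => //; exists x.
by exists s' => // x /= dx0; rewrite ds' /= dx0 linear0 subr0.
Qed.

End TwoResolutions.

(* [tau] is [d] followed by an equivariant section of [d] over its image. *)
Definition image_splitting (M N : premod G) (d : {linear M -> N})
    (tau : {linear M -> M}) : Prop :=
  [/\ equivariant H tau, forall y, d (tau y) = d y & forall y, d y = 0 -> tau y = 0].

Lemma image_splitting_transfer (N : premod G) (A B : nat -> premod G)
    (dA : forall k, {linear aug_mod N A k.+1 -> aug_mod N A k})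
    (dB : forall k, {linear aug_mod N B k.+1 -> aug_mod N B k}) m
    (tau : {linear aug_mod N B m.+1 -> aug_mod N B m.+1}) :
  resolution dA m -> resolution dB m -> image_splitting (dB m) tau ->
  exists (a : {linear aug_mod N A m -> aug_mod N B m})
         (a' : {linear aug_mod N A m.+1 -> aug_mod N B m.+1})
         (b' : {linear aug_mod N B m.+1 -> aug_mod N A m.+1})
         (s : {linear aug_mod N A m -> aug_mod N A m.+1}),
  [/\ [/\ equivariant H a, equivariant H a', equivariant H b' & equivariant H s],
      dB m \o a' =1 a \o dA m &
      image_splitting (dA m) ((b' \o (tau \o a')) \- (s \o dA m))].
Proof.
move=> resA resB [tauH dtau tau0].
have [a [aH da] a_0] := chain_map_lift resA resB (@equivariant_id _ H N).
have [b [bH db] b_0] := chain_map_lift resB resA (@equivariant_id _ H N).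
have ba_chain : chain_map dA dA m (fun k => b k \o a k).
  split=> k km; first by apply: equivariant_comp; [apply: bH|apply: aH].
  by move=> x /=; rewrite db // da.
have id_chain : chain_map dA dA m (fun=> idfun) by split.
have [|s sH ds] := chain_homotopy resA resA ba_chain id_chain _ (leqnn m).
  by move=> x /=; rewrite a_0 b_0.
have [discA _ dAH exA] := resA.
exists (a m), (a m.+1), (b m.+1), s; split.
- by split=> //; [apply: aH|apply: aH|apply: bH].
- exact: da.
split=> [|y|y dy0].
- apply: equivariantB; first exact: discA.
    by do 2?[apply: equivariant_comp => //]; [apply: bH|apply: aH].
  by apply: equivariant_comp sH _; apply: dAH.
- rewrite linearB /= db // dtau da // ds; first by rewrite opprB addrC subrK.
  by apply/exA => //; exists y.
- by rewrite /= tau0 ?da // dy0 ?linear0 ?addr0.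
Qed.

End Resolutions.

Lemma image_splittingS (G : tgroup) (H H' : set G) (M N : premod G)
    (d : {linear M -> N}) (tau : {linear M -> M}) :
  H' `<=` H -> image_splitting H d tau -> image_splitting H' d tau.
Proof. by move=> sH'H [tauH dtau tau0]; split=> //; apply: equivariantS tauH. Qed.

Section Image.
Variables (G : tgroup) (M N : premod G) (p : {linear M -> N}).

Definition image_pred : {pred N} := [pred y | `[< exists x, p x = y >]].

Lemma image_pred_submod_closed : submod_closed image_pred.
Proof.
split; first by apply/asboolP; exists 0; apply: linear0.
move=> c _ _ /asboolP[x <-] /asboolP[y <-].
by apply/asboolP; exists (c *: x + y); apply: linearP.
Qed.

HB.instance Definition _ :=
  GRing.isSubmodClosed.Build rat N image_pred image_pred_submod_closed.

Inductive image_of : predArgType := ImageOf y & y \in image_pred.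
Definition image_val w : N := let: ImageOf y _ := w in y.
HB.instance Definition _ := [isSub of image_of for image_val].
HB.instance Definition _ := [Choice of image_of by <:].
HB.instance Definition _ := [SubChoice_isSubZmodule of image_of by <:].
HB.instance Definition _ := [SubZmodule_isSubLmodule of image_of by <:].

Definition image_act (h : G) (w : image_of) : image_of :=
  insubd w (pm_act N h (val w)).

Definition image_premod : premod G := PreMod image_act.

Variable H : set G.
Hypothesis pH : equivariant H p.

Lemma val_image_act h w : H h -> val (image_act h w) = pm_act N h (val w).
Proof.
move=> Hh; rewrite val_insubd; case: w => _ /= /asboolP[x <-].
by case: ifPn => // /asboolP[]; exists (pm_act M h x); apply: pH.
Qed.

Lemma image_discrete : subgroup H -> discrete H N -> discrete H image_premod.
Proof.
move=> [H1 HM _] [aD aZ a1 aM aO]; split=> [h Hh x y|h Hh c x|x|g h Hg Hh x|x].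
- by apply: val_inj; rewrite /= !val_image_act // aD.
- by apply: val_inj; rewrite /= !val_image_act // aZ.
- by apply: val_inj; rewrite /= val_image_act // a1.
- by apply: val_inj; rewrite /= !val_image_act //; [apply: aM|apply: HM].
have [V [oV stabV]] := aO (val x); exists V; split=> //; rewrite -stabV.
apply/seteqP; split=> h [Hh /= hx]; split=> //.
  by rewrite -val_image_act // hx.
by apply: val_inj; rewrite val_image_act.
Qed.

End Image.

Definition premod_of_dmod (G : tgroup) (H : set G) (M : dmod H) : premod G :=
  PreMod (dm_act M).

(* [f] is lifted along the corestriction of [p] to its image. *)
Lemma dprojective_lifting_property (G : tgroup) (H : set G) (P : dmod H) :
  subgroup H -> dprojective P -> lifting_property H (premod_of_dmod P).
Proof.
move=> subH projP M N p f discM discN pH fH f_im.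
have im_f x : f x \in image_pred p by apply/asboolP; apply: f_im.
have im_p y : p y \in image_pred p by apply/asboolP; exists y.
have discI := image_discrete pH subH discN.
have [|||g [[gD gZ gH] pg]] := projP (DMod discM) (DMod discI)
  (fun y => ImageOf (im_p y)) (fun x => ImageOf (im_f x)).
- split=> [x y|c x|h Hh x]; apply: val_inj => /=.
  + exact: linearD.
  + exact: linearZ.
  + by rewrite (val_image_act pH (ImageOf (im_p x)) Hh) /= pH.
- split=> [x y|c x|h Hh x]; apply: val_inj => /=.
  + exact: linearD.
  + exact: linearZ.
  + by rewrite (val_image_act pH (ImageOf (im_f x)) Hh) /= -fH.
- by move=> [u im_u]; have /asboolP[y py] := im_u; exists y; apply: val_inj.
have g_linear : linear (g : premod_of_dmod P -> M) := additive_scalable_linear gD gZ.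
exists (linear_of g); first by rewrite (linear_ofE g_linear).
by move=> x; rewrite (linear_ofE g_linear); have /(congr1 val) := pg x.
Qed.

Section GroupActions.
Variables (G : tgroup) (H : set G).
Hypothesis lawsG : group_laws G.
Hypothesis mulG_continuous : continuous (fun p : G * G => tg_mul p.1 p.2).
Hypothesis subH : subgroup H.

Lemma lmul_continuous (g : G) : continuous (tg_mul g).
Proof.
move=> x; apply: (@continuous_comp _ _ _ (pair g) (fun p => tg_mul p.1 p.2)).
  by apply: cvg_pair => /=; [exact: cvg_cst|exact: cvg_id].
exact: mulG_continuous.
Qed.

Section Action.
Variables (T : Type) (act : G -> T -> T).

Definition action : Prop :=
  (forall x, act tg_one x = x) /\
  forall g h, H g -> H h -> forall x, act (tg_mul g h) x = act g (act h x).

Definition stab x : set G := [set h | H h /\ act h x = x].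

Hypothesis act_action : action.

Lemma actK g : H g -> cancel (act g) (act (tg_inv g)).
Proof.
case: lawsG subH act_action => [_ _ gV] [_ _ HV] [act1 actM].
by move=> Hg x; rewrite -actM ?(gV g).1 //; apply: HV.
Qed.

Lemma actKV g : H g -> cancel (act (tg_inv g)) (act g).
Proof.
case: lawsG subH act_action => [_ _ gV] [_ _ HV] [act1 actM].
by move=> Hg x; rewrite -actM ?(gV g).2 //; apply: HV.
Qed.

Lemma act_eq_stab x g h : H g -> H h ->
  act h x = act g x <-> stab x (tg_mul (tg_inv g) h).
Proof.
case: subH (act_action) => [_ HM HV] [_ actM].
move=> Hg Hh; have HVg := HV _ Hg; split=> [hg|[_]].
  by split; [exact: HM|rewrite actM // hg actK].
by rewrite actM // => /(congr1 (act g)); rewrite actKV.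
Qed.

Lemma stab_subgroup x : subgroup (stab x).
Proof.
case: (subH) (act_action) => [H1 HM HV] [act1 actM].
split=> [|g h [Hg gx] [Hh hx]|h [Hh hx]]; split; rewrite ?act1 //; auto.
  by rewrite actM // hx.
by rewrite -{1}hx actK.
Qed.

Lemma open_stab x :
  (\forall h \near tg_one, H h -> act h x = x) -> open_in H (stab x).
Proof.
case: lawsG (subH) => [_ _ gV] [_ HM HV] near1.
exists [set h | H h -> act h x = x]°; split; first exact: open_interior.
apply/seteqP; split=> [g [Hg gx]|g [/interior_subset fixes Hg]]; last by split; auto.
split=> //; have HVg := HV _ Hg.
have shift : tg_mul (tg_inv g) h @[h --> g] --> (tg_one : G).
  by rewrite -(gV g).1; apply: lmul_continuous.
apply: (@filterS _ (nbhs g)) (shift _ near1) => h fixes Hh.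
rewrite -{2}gx; apply/act_eq_stab => //.
by split; [exact: HM|apply: fixes; apply: HM].
Qed.

End Action.

Lemma finite_orbit (T : choiceType) (act : G -> T -> T) x (K : set G) :
  action act -> K `<=` H -> compact K -> open_in H (stab act x) ->
  finite_set (act^~ x @` K).
Proof.
case: lawsG (subH) => [_ _ gV] [H1 HM HV].
move=> actT KH cK [V [oV stabV]].
pose pG : ptopologicalType := HB.pack (tg_car G) (isPointed.Build G tg_one).
have : cover_compact (T := pG) K by rewrite -compact_cover.
have V1 : V tg_one.
  by suff [] : (V `&` H) tg_one by []; rewrite -stabV; split=> //; case: actT.
case/(_ G K (fun u => [set h | V (tg_mul (tg_inv u) h)])) => [u _|u Ku|D DK covD].
- by apply: open_comp => // h _; apply: lmul_continuous.
- by exists u => //=; rewrite (gV u).1.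
apply: sub_finite_set (finite_image (act^~ x) (finite_fset D)).
move=> _ [h Kh <-]; have [u uD Vuh] := covD h Kh; exists u => //.
have Hu : H u by apply/KH/set_mem/DK.
have Hh := KH _ Kh; apply/esym/(act_eq_stab actT _ Hu Hh).
by rewrite stabV; split=> //; apply: HM => //; apply: HV.
Qed.

Lemma orbit_transversal (T : choiceType) (act : G -> T -> T) : action act ->
  exists (r : T -> T) (t : T -> G), [/\ forall h w, H h -> r (act h w) = r w,
    forall w, H (t w) & forall w, act (t w) (r w) = w].
Proof.
case: (subH) => H1 HM HV actT; case: (actT) => act1 actM.
pose orbit w v := `[< exists2 h, H h & v = act h w >].
have orbit_refl w : orbit w w by apply/asboolP; exists tg_one; rewrite ?act1.
have orbit_act h w : H h -> orbit (act h w) =1 orbit w.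
  move=> Hh v; apply/asboolP/asboolP => -[g Hg ->].
    by exists (tg_mul g h); rewrite ?actM //; apply: HM.
  exists (tg_mul g (tg_inv h)); first by apply: HM => //; apply: HV.
  by rewrite actM ?(actK actT) //; apply: HV.
pose r w := choose (orbit w) w.
have /choice[t tP] w : exists t, H t /\ act t (r w) = w.
  have /asboolP[h Hh rw] := chooseP (orbit_refl w).
  by exists (tg_inv h); rewrite /r rw (actK actT) //; split=> //; apply: HV.
exists r, t; split=> [h w Hh|w|w]; try by case: (tP w).
rewrite /r (eq_choose (orbit_act h w Hh)); apply: choose_id => //.
by apply/asboolP; exists h.
Qed.

(* A value fixed by the stabilizer of an orbit representative is transported
   along the orbit. *)
Lemma equivariant_choice (T : choiceType) (U : Type) (actT : G -> T -> T)
    (actU : G -> U -> U) (R : T -> U -> Prop) :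
  action actT -> action actU ->
  (forall h w u, H h -> R w u -> R (actT h w) (actU h u)) ->
  (forall w, exists u, R w u /\ stab actT w `<=` stab actU u) ->
  exists2 g : T -> U, forall w, R w (g w) &
    forall h w, H h -> g (actT h w) = actU h (g w).
Proof.
case: (subH) => _ HM _ actTP actUP Ract /choice[z zP].
have [r [t [r_act Ht tr]]] := orbit_transversal actTP.
exists (fun w => actU (t w) (z (r w))) => [w|h w Hh].
  by rewrite -{1}(tr w); apply: Ract => //; case: (zP (r w)).
have Hht : H (tg_mul h (t w)) by apply: HM.
case: (actTP) (actUP) => [_ TM] [_ UM].
rewrite r_act // -UM //; apply/esym/(act_eq_stab actUP _ (Ht _) Hht).
apply: (zP (r w)).2; apply/(act_eq_stab actTP _ (Ht _) Hht).
by rewrite TM // tr -[in RHS](r_act h w) ?tr.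
Qed.

Lemma discrete_action (M : premod G) : discrete H M -> action (pm_act M).
Proof. by case. Qed.

Section Averaging.
Variables (M : premod G) (K : set G).
Hypotheses (discM : discrete H M) (subK : subgroup K) (KH : K `<=` H) (cK : compact K).

Lemma orbit_average y : exists s : seq M,
  [/\ s != [::], forall x, x \in s -> exists2 u, K u & x = pm_act M u y &
      forall h, K h -> pm_act M h (\sum_(x <- s) x) = \sum_(x <- s) x].
Proof.
have actM := discrete_action discM; have [K1 KM _] := subK.
have [_ _ _ _ stab_open] := discM.
have /finite_seqP[s0 Ks0] := finite_orbit actM KH cK (stab_open y).
have sP x : x \in undup s0 <-> exists2 u, K u & x = pm_act M u y.
  have : x \in undup s0 <-> ((pm_act M)^~ y @` K) x by rewrite Ks0 /= mem_undup.
  by move=> ->; split=> -[u Ku]; exists u.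
exists (undup s0); split=> [|x /sP //|h Kh].
  have : pm_act M tg_one y \in undup s0 by apply/sP; exists tg_one.
  by case: undup.
have act_lin := linear_ofE (act_linear discM (KH Kh)).
rewrite -act_lin linear_sum /= act_lin -(big_map (pm_act M h) xpredT id).
have act_uniq : uniq (map (pm_act M h) (undup s0)).
  by rewrite map_inj_uniq ?undup_uniq //; apply: can_inj (actK actM (KH Kh)).
have act_sub : {subset map (pm_act M h) (undup s0) <= undup s0}.
  move=> _ /mapP[x /sP[u Ku ->] ->]; apply/sP; exists (tg_mul h u); first exact: KM.
  by case: actM => _ ->; auto.
apply: perm_big; apply: uniq_perm; rewrite ?undup_uniq //.
by have [|_ mem_eq] := uniq_min_size act_uniq act_sub; rewrite ?size_map.
Qed.

Lemma invariant_lift (N : premod G) (p : {linear M -> N}) y :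
  equivariant H p -> (forall h, K h -> pm_act N h (p y) = p y) ->
  exists2 z, p z = p y & forall h, K h -> pm_act M h z = z.
Proof.
move=> pH fix_py; have [s [s_nil s_orbit s_fix]] := orbit_average y.
exists ((size s)%:R^-1 *: \sum_(x <- s) x) => [|h Kh].
  rewrite linearZ linear_sum /= (eq_big_seq (fun=> p y)) => [|_ /s_orbit[u Ku ->]].
    rewrite big_const_seq count_predT iter_addr_0 -scaler_nat scalerA mulVf ?scale1r //.
    by rewrite pnatr_eq0 size_eq0.
  by rewrite pH ?fix_py //; apply: KH.
by have [_ aZ _ _ _] := discM; rewrite aZ ?s_fix //; apply: KH.
Qed.

End Averaging.

End GroupActions.

Section FreeModule.
Variables (R : nzRingType) (K : choiceType) (V : lmodType R).
Implicit Types (x : {freeg K / R}).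

Lemma freegE x : x = \sum_(w <- dom x) coeff w x *: << w >>.
Proof.
rewrite -{1}(freeg_sumE x); apply: eq_bigr => w _.
by apply/eqP/freeg_eqP => v; rewrite coeffZ !coeffU mul1r.
Qed.

HB.instance Definition _ (f : K -> V) :=
  GRing.isZmodMorphism.Build {freeg K / R} V (fglift f) (lift_is_additive f).

Lemma fglift_scalable (f : K -> V) : scalable (fglift f).
Proof.
have scaleU c k w : c *: << k *g w >> = << (c * k) *g w >> :> {freeg K / R}.
  by apply/eqP/freeg_eqP => v; rewrite coeffZ !coeffU mulrA.
move=> c x; rewrite -(freeg_sumE x) scaler_sumr !raddf_sum.
by apply: eq_bigr => w _ /=; rewrite scaleU !liftU scalerA.
Qed.

HB.instance Definition _ (f : K -> V) :=
  GRing.isScalable.Build R {freeg K / R} V *:%R (fglift f) (fglift_scalable f).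

Lemma freeg_linear_eq (f g : {linear {freeg K / R} -> V}) :
  (forall w, f << w >> = g << w >>) -> f =1 g.
Proof.
move=> fg x; rewrite (freegE x) !linear_sum; apply: eq_bigr => w _.
by rewrite !linearZ fg.
Qed.

End FreeModule.

Section PermutationModule.
Variables (G : tgroup) (H : set G) (O : hset H).

HB.instance Definition _ (h : G) :=
  GRing.Linear.copy (@QP_act G H O h) (fglift (fun w : O => << hs_act O h w >> : QP O)).

Definition perm_premod : premod G := @PreMod G {freeg O / rat} (@QP_act G H O).

Lemma QP_actU h w : QP_act h (<< w >> : QP O) = << hs_act O h w >>.
Proof. by rewrite /QP_act liftU scale1r. Qed.

End PermutationModule.

Section ProperPermutation.
Variables (G : tgroup) (H H' : set G) (O : hset H').
Hypothesis lawsG : group_laws G.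
Hypothesis mulG_continuous : continuous (fun p : G * G => tg_mul p.1 p.2).
Hypothesis subH : subgroup H.

Definition proper_hset : Prop :=
  action H (hs_act O) /\ forall w, compact_open_in H (stab H (hs_act O) w).

Hypothesis properO : proper_hset.

Lemma QP_act_action : action H (@QP_act G H' O).
Proof.
case: properO => -[a1 aM] _; split=> [x|g h Hg Hh x].
  apply: (freeg_linear_eq (f := QP_act tg_one) (g := idfun)) => w.
  by rewrite /= QP_actU a1.
apply: (freeg_linear_eq (f := QP_act (tg_mul g h)) (g := QP_act g \o QP_act h)) => w.
by rewrite /= !QP_actU aM.
Qed.

Lemma perm_discrete : discrete H (perm_premod O).
Proof.
case: (QP_act_action) => b1 bM; split=> // [h _|h _|x]; [exact: linearD|exact: linearZZ|].
apply: (open_stab lawsG mulG_continuous subH QP_act_action).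
have near_fix : \forall h \near tg_one, H h -> forall w, w \in dom x -> hs_act O h w = w.
  case: subH properO => H1 _ _ [[a1 _] properS].
  elim: (dom x) => [|w s]; first by apply: nearW.
  have [_ _ [V [oV stabV]]] := properS w; have : (V `&` H) tg_one by rewrite -stabV.
  move=> [V1 _]; apply: filterS2 (open_nbhs_nbhs (conj oV V1)) => h Vh fix_s Hh v.
  rewrite inE => /orP[/eqP ->|]; last exact: fix_s.
  by have [] : stab H (hs_act O) w h by rewrite stabV.
apply: filterS near_fix => h fix_dom Hh.
rewrite {1}(freegE x) [RHS](freegE x) linear_sum !big_seq; apply: eq_bigr => w wx.
by rewrite linearZ /= QP_actU fix_dom.
Qed.

Lemma perm_lifting_property : lifting_property H (perm_premod O).
Proof.
move=> M N p f discM discN pH fH f_im.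
have [actO properS] := properO; have actM := discrete_action discM.
pose lifts w z := p z = f << w >>.
have lifts_act h w z : H h -> lifts w z -> lifts (hs_act O h w) (pm_act M h z).
  by move=> Hh pz; rewrite /lifts pH // pz -fH //= QP_actU.
have [w|g g_lifts gH] := equivariant_choice lawsG subH actO actM lifts_act.
  have [y py] := f_im << w >>; have [stabH cS _] := properS w.
  have [h [Hh hw]|z pz z_fix] := invariant_lift lawsG mulG_continuous subH discM
      (stab_subgroup lawsG subH actO w) stabH cS pH (y := y).
    by rewrite py -fH //= QP_actU hw.
  by exists z; rewrite /lifts pz py; split=> // h Sh; split; [apply: stabH|apply: z_fix].
exists (fglift g) => [h Hh x|x].
  have act_lin := linear_ofE (act_linear discM Hh); rewrite -act_lin.
  apply: (freeg_linear_eq (f := fglift g \o QP_act h)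
    (g := linear_of (pm_act M h) \o fglift g)) => w.
  by rewrite /= QP_actU act_lin !liftU !scale1r gH.
apply: (freeg_linear_eq (f := p \o fglift g) (g := f)) => w.
by rewrite /= liftU scale1r g_lifts.
Qed.

End ProperPermutation.

Lemma proper_fin_hset_restrict (G : tgroup) (H H' : set G) (O : hset H') :
  closed H -> H `<=` H' -> proper_fin_hset O -> proper_hset H O.
Proof.
move=> clH sHH' [a1 aM aS _].
split=> [|w]; first by split=> // g h Hg Hh w; apply: aM (sHH' _ Hg) (sHH' _ Hh) w.
have [_ cS [V [oV stabV]]] := aS w.
have stabE : stab H (hs_act O) w = [set h | H' h /\ hs_act O h w = w] `&` H.
  apply/seteqP; split=> [h [Hh hw]|h [[_ hw] Hh]]; split=> //.
  by split=> //; apply: sHH'.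
rewrite stabE; split; first exact: subIsetr.
  exact: compact_closedI.
by exists V; split=> //; rewrite stabV -setIA (setIidr sHH').
Qed.

Section Norm.
Variables (G : tgroup) (H : set G) (O : hset H).
Implicit Types x y : QP O.

Lemma norm1E x (s : seq O) : uniq s -> {subset dom x <= s} ->
  norm1 x = \sum_(w <- s) `|coeff w x|.
Proof.
move=> s_uniq dom_s; rewrite /norm1 [RHS](bigID (mem (dom x))) /=.
rewrite [X in _ = _ + X]big1 ?addr0 => [|w /coeff_outdom ->]; last by rewrite normr0.
rewrite -[RHS]big_filter; apply/perm_big/uniq_perm; rewrite ?filter_uniq ?uniq_dom //.
by move=> w; rewrite mem_filter; case: (boolP (w \in dom x)) => //= /dom_s ->.
Qed.

Lemma norm1_ge0 x : 0 <= norm1 x.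
Proof. exact: sumr_ge0. Qed.

Lemma norm1_0 : norm1 (0 : QP O) = 0.
Proof. by rewrite /norm1 dom0 big_nil. Qed.

Lemma norm1D x y : norm1 (x + y) <= norm1 x + norm1 y.
Proof.
pose s := undup (dom x ++ dom y).
rewrite !(@norm1E _ s) ?undup_uniq //.
- by rewrite -big_split /=; apply: ler_sum => w _; rewrite coeffD ler_normD.
- by move=> w; rewrite mem_undup mem_cat orbC => ->.
- by move=> w; rewrite mem_undup mem_cat => ->.
- by move=> w /domD_subset; rewrite mem_undup.
Qed.

Lemma norm1Z c x : norm1 (c *: x) = `|c| * norm1 x.
Proof.
rewrite (@norm1E _ (dom x)) ?uniq_dom //; last exact: domZ_subset.
by rewrite mulr_sumr; apply: eq_bigr => w _; rewrite coeffZ normrM.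
Qed.

Lemma norm1B x y : norm1 (x - y) <= norm1 x + norm1 y.
Proof. by rewrite (le_trans (norm1D _ _)) // -scaleN1r norm1Z normrN1 mul1r. Qed.

Lemma norm1U (w : O) : norm1 (<< w >> : QP O) = 1.
Proof. by rewrite /norm1 domU1 big_seq1 coeffU eqxx mulr1 normr1. Qed.

Lemma norm1_sum I (r : seq I) (F : I -> QP O) :
  norm1 (\sum_(i <- r) F i) <= \sum_(i <- r) norm1 (F i).
Proof.
elim/big_ind2: _ => [|x a y b xa yb|//]; first by rewrite norm1_0.
by rewrite (le_trans (norm1D _ _)) // lerD.
Qed.

End Norm.

Section LinearMaps.
Variables (G : tgroup) (H1 H2 : set G) (O1 : hset H1) (O2 : hset H2).
Variable f : {linear QP O1 -> QP O2}.

Lemma norm1_linear_le C (x : QP O1) :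
  (forall w, w \in dom x -> norm1 (f << w >>) <= C) -> norm1 (f x) <= C * norm1 x.
Proof.
move=> fC; rewrite {1}(freegE x) linear_sum (le_trans (norm1_sum _ _)) //.
rewrite /norm1 mulr_sumr !big_seq; apply: ler_sum => w wx.
by rewrite linearZ -/(norm1 _) norm1Z mulrC ler_wpM2r // fC.
Qed.

Lemma dom_linear (x : QP O1) v :
  v \in dom (f x) -> exists2 w, w \in dom x & v \in dom (f << w >>).
Proof.
rewrite {1}(freegE x) linear_sum => /dom_sum_subset/flatten_mapP[w].
rewrite mem_filter => /andP[_ wx]; rewrite linearZ => /domZ_subset vfw.
by exists w.
Qed.

End LinearMaps.

Lemma norm1_act (G : tgroup) (H : set G) (O : hset H) h (x : QP O) :
  norm1 (QP_act h x) <= norm1 x.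
Proof.
by rewrite -[leRHS]mul1r; apply: norm1_linear_le => w _; rewrite /= QP_actU norm1U.
Qed.

Section Domination.
Variable G : tgroup.

Definition dominated (T : Type) (H1 H2 : set G) (O1 : hset H1) (O2 : hset H2)
    (f : T -> QP O1) (g : T -> QP O2) : Prop :=
  exists2 C : rat, 0 <= C & forall y, norm1 (f y) <= C * norm1 (g y).

Section DominatedTheory.
Variables (T : Type) (H1 H2 H3 : set G) (O1 : hset H1) (O2 : hset H2) (O3 : hset H3).

Lemma dominated_trans (g : T -> QP O2) (f : T -> QP O1) (h : T -> QP O3) :
  dominated f g -> dominated g h -> dominated f h.
Proof.
move=> [C C0 fg] [D D0 gh]; exists (C * D) => [|y]; first exact: mulr_ge0.
by rewrite -mulrA (le_trans (fg y)) // ler_wpM2l.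
Qed.

Lemma dominatedB (f f' : T -> QP O1) (g : T -> QP O2) :
  dominated f g -> dominated f' g -> dominated (fun y => f y - f' y) g.
Proof.
move=> [C C0 fg] [D D0 f'g]; exists (C + D) => [|y]; first exact: addr_ge0.
by rewrite mulrDl (le_trans (norm1B _ _)) // lerD.
Qed.

Lemma dominated_comp (U : Type) (u : U -> T) (f : T -> QP O1) (g : T -> QP O2) :
  dominated f g -> dominated (f \o u) (g \o u).
Proof. by move=> [C C0 fg]; exists C => // y; apply: fg. Qed.

End DominatedTheory.

Definition finite_orbits (H H1 : set G) (O : hset H1) : Prop :=
  exists s : seq O, forall w : O, exists2 w0, w0 \in s &
    exists h, H h /\ w = hs_act O h w0.

(* The elements [f x] are all supported on the orbits met by [f] on finitely many
   basis elements, and on these [g] is bounded. *)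
Lemma equivariant_dominated (H H1 H2 H3 : set G)
    (O1 : hset H1) (O2 : hset H2) (O3 : hset H3)
    (f : {linear perm_premod O1 -> perm_premod O2})
    (g : {linear perm_premod O2 -> perm_premod O3}) :
  finite_orbits H O1 -> equivariant H f -> equivariant H g ->
  dominated (O1 := O3) (O2 := O2) (g \o f) f.
Proof.
move=> [s sP] fH gH; pose S := flatten [seq dom (f << u >> : QP O2) | u <- s].
have dom_f (x : QP O1) v : v \in dom (f x : QP O2) ->
    exists2 v0, v0 \in S & exists2 h, H h & v = hs_act O2 h v0.
  move=> /dom_linear[w _]; have [u us [h [Hh ->]]] := sP w.
  rewrite -QP_actU (fH h Hh) => /dom_linear[v0 v0u].
  rewrite /= QP_actU domU1 inE => /eqP ->; exists v0; last by exists h.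
  by apply/flatten_mapP; exists u.
exists (\sum_(v <- S) norm1 (g << v >> : QP O3)).
  by apply: sumr_ge0 => v _; apply: norm1_ge0.
move=> x; apply: norm1_linear_le => _ /dom_f[v0 v0S [h Hh ->]].
rewrite -QP_actU (gH h Hh) (le_trans (norm1_act _ _)) //.
by rewrite (big_rem v0) //= lerDl; apply: sumr_ge0 => v _; apply: norm1_ge0.
Qed.

Lemma equivariant_bounded (H H1 H2 : set G) (O1 : hset H1) (O2 : hset H2)
    (f : {linear perm_premod O1 -> perm_premod O2}) :
  finite_orbits H O1 -> equivariant H f -> dominated (O1 := O2) (O2 := O1) f id.
Proof.
by move=> finO fH; apply: (equivariant_dominated (f := idfun) (g := f) finO _ fH).
Qed.

(* [tau] takes the same value at [y] and at an almost minimal filling of [d y]. *)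
Lemma image_splitting_dominated (H H1 H2 : set G) (O1 : hset H1) (O2 : hset H2)
    (d : {linear perm_premod O1 -> perm_premod O2})
    (tau : {linear perm_premod O1 -> perm_premod O1}) (C : rat) :
  image_splitting H d tau -> dominated (O1 := O1) (O2 := O1) tau id -> 0 <= C ->
  (forall (y : QP O1) eps, 0 < eps -> exists z : QP O1,
    d z = d y /\ norm1 z <= C * norm1 (d y : QP O2) + eps) ->
  dominated (O1 := O1) (O2 := O2) tau d.
Proof.
move=> [_ _ tau0] [D D0 tauD] C0 fill; have D1 : 0 < D + 1 by rewrite ltr_wpDl.
exists ((D + 1) * C) => [|y]; first by rewrite mulr_ge0 // ltW.
apply/ler_addgt0Pr => eps eps0; have [z [dz z_le]] := fill y _ (divr_gt0 eps0 D1).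
have -> : tau y = tau z.
  by apply/eqP; rewrite -subr_eq0 -linearB tau0 // linearB /= dz subrr.
rewrite (le_trans (tauD z)) // (le_trans (ler_wpM2r (norm1_ge0 _) (_ : D <= D + 1))) //.
  by rewrite lerDl.
rewrite (le_trans (ler_wpM2l (ltW D1) z_le)) // mulrDr mulrA lerD2l.
by rewrite mulrCA divff ?mulr1 // gt_eqF.
Qed.

End Domination.

Definition triv_premod (G : tgroup) : premod G := @PreMod G rat^o (fun _ x => x).

Section PermutationResolution.
Variables (G : tgroup) (H' : set G) (m : nat) (Om : nat -> hset H').
Variables (d : forall i, QP (Om i.+1) -> QP (Om i)) (e : QP (Om 0%N) -> rat).
Arguments d : clear implicits.
Hypothesis res : perm_resolution m d e.

Definition perm_aug_diff := @aug_diff G (triv_premod G) (fun i => perm_premod (Om i)) d e.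

Lemma perm_aug_diffE i : (i < m)%N -> perm_aug_diff i.+1 = d i :> (_ -> _).
Proof.
move=> im; case: res => _ dP _ _ _; apply: linear_ofE.
by case: (dP i im) => dD dZ _; apply: additive_scalable_linear.
Qed.

Lemma perm_aug_diff0E : perm_aug_diff 0%N = e :> (_ -> _).
Proof. by case: res => _ _ [eD eZ _] _ _; apply/linear_ofE/additive_scalable_linear. Qed.

Lemma perm_aug_resolution H : TDLC G -> closed_subgroup H -> H `<=` H' ->
  resolution H perm_aug_diff m.
Proof.
move=> [lawsG mulG _ _] [clH H1 HM HV] sHH'; have subH : subgroup H by split.
case: res => properOm dP [_ _ eH] e_surj exact_d.
have proper k (km : (k <= m)%N) := proper_fin_hset_restrict clH sHH' (properOm k km).
split=> [[|k] km|k km|[|k] km|[|k] km x].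
- exact: triv_dmod_axioms.
- exact: (perm_discrete lawsG mulG subH (proper k km)).
- exact: (perm_lifting_property lawsG mulG subH (proper k km)).
- by rewrite perm_aug_diff0E => h /sHH'; apply: eH.
- by rewrite perm_aug_diffE // => h /sHH'; case: (dP k km) => _ _; apply.
- by rewrite perm_aug_diff0E; split.
- rewrite perm_aug_diffE // -(exact_d k km x).
  case: k km x => [|k] km x /=; first by rewrite perm_aug_diff0E.
  by rewrite perm_aug_diffE // ltnW.
Qed.

End PermutationResolution.

Section Isoperimetry.
Variables (G : tgroup) (H : set G) (n : nat) (Om : nat -> hset H).
Variables (d : forall i, QP (Om i.+1) -> QP (Om i)) (e : QP (Om 0%N) -> rat).
Arguments d : clear implicits.
Hypothesis res : perm_resolution n.+1 d e.
Variable tau : {linear perm_premod (Om n.+1) -> perm_premod (Om n.+1)}.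
Hypothesis tau_splits : image_splitting H (perm_aug_diff d e n.+1) tau.

Lemma isoperimetric_splitting_dominated C : 0 < C ->
  (forall x : QP (Om n), dker d e x -> forall eps, 0 < eps ->
     exists y : QP (Om n.+1), d n y = x /\ norm1 y <= C * norm1 x + eps) ->
  dominated (O1 := Om n.+1) (O2 := Om n) tau (perm_aug_diff d e n.+1).
Proof.
have [properOm _ _ _ exact_d] := res; have dE := perm_aug_diffE res (ltnSn n).
move=> C0 iso; have [tauH _ _] := tau_splits.
have [_ _ _ finO] := properOm n.+1 (leqnn _).
apply: image_splitting_dominated tau_splits (equivariant_bounded finO tauH) (ltW C0) _.
move=> y eps eps0; rewrite dE; apply: iso eps0.
by apply/(exact_d n (ltnSn n)); exists y.
Qed.

Lemma dominated_splitting_isoperimetric :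
  dominated (O1 := Om n.+1) (O2 := Om n) tau (perm_aug_diff d e n.+1) ->
  weak_lin_isoperimetric H n.
Proof.
have [_ _ _ _ exact_d] := res; have dE := perm_aug_diffE res (ltnSn n).
have [_ dtau _] := tau_splits; rewrite dE in dtau *.
move=> [C C0 tauC]; exists Om, d, e; split=> //.
exists (C + 1); split=> [|x x_cycle eps eps0]; first by rewrite ltr_wpDl.
have [y <-] := (exact_d n (ltnSn n) x).1 x_cycle.
exists (tau y); rewrite dtau; split=> //; rewrite (le_trans (tauC y)) //.
by rewrite ler_wpDr ?(ltW eps0) // ler_wpM2r ?norm1_ge0 // lerDl.
Qed.

End Isoperimetry.

Lemma dmod_aug_resolution (G : tgroup) (H : set G) (P : nat -> dmod H)
    (d : forall i, P i.+1 -> P i) (aug : P 0%N -> triv_dmod H) m :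
  subgroup H -> (forall i, dprojective (P i)) -> (forall i, dhom (d i)) ->
  dhom aug -> (forall y, exists x, aug x = y) ->
  (forall x, aug x = 0 <-> exists y, d 0%N y = x) ->
  (forall i (x : P i.+1), d i x = 0 <-> exists y, d i.+1 y = x) ->
  resolution H (@aug_diff G (triv_premod G) (fun i => premod_of_dmod (P i)) d aug) m.
Proof.
move=> subH projP dP [augD augZ augH] aug_surj exact0 exactS.
have dE i : linear_of (d i) = d i :> (_ -> _).
  by case: (dP i) => dD dZ _; apply/linear_ofE/additive_scalable_linear.
have augE : linear_of (aug : premod_of_dmod (P 0%N) -> triv_premod G) = aug :> (_ -> _).
  exact/linear_ofE/additive_scalable_linear.
split=> [[|k] _|k _|[|k] _|[|[|k]] _ x] /=.
- exact: triv_dmod_axioms.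
- exact: dm_ax.
- exact: dprojective_lifting_property.
- by rewrite augE.
- by rewrite dE; case: (dP k).
- by rewrite augE; split.
- by rewrite augE dE.
- by rewrite !dE.
Qed.

Lemma top_diff_image_splitting (G : tgroup) (H : set G) n (Om : nat -> hset H)
    (d : forall i, QP (Om i.+1) -> QP (Om i)) (e : QP (Om 0%N) -> rat) :
  TDLC G -> closed_subgroup H ->
  perm_resolution n.+1 d e -> has_proj_resolution H n.+1 ->
  exists tau, image_splitting H (perm_aug_diff d e n.+1) tau.
Proof.
move=> tdlc clH res [P [dP [aug [projP dP_hom aug_hom [P0 aug_surj exact0 exactS]]]]].
have subH : subgroup H by case: clH.
have resA := perm_aug_resolution res tdlc clH (@subset_refl _ H).
have resB := dmod_aug_resolution n.+1 subH projP dP_hom aug_hom aug_surj exact0 exactS.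
have splitB : image_splitting H
    (@aug_diff G (triv_premod G) (fun i => premod_of_dmod (P i)) dP aug n.+1) idfun.
  split=> // y; rewrite /= linear_ofE; last first.
    by case: (dP_hom n) => dD dZ _; apply: additive_scalable_linear.
  move=> /exactS[z <-]; rewrite (P0 n.+2 _ z) //.
  by case: (dP_hom n.+1) => _ /(_ 0 0) + _; rewrite !scale0r.
have [a [a' [b' [s [_ _ splitA]]]]] := image_splitting_transfer resA resB splitB.
by eexists; exact: splitA.
Qed.

Theorem theorem1p5 (G : tgroup) (n : nat) :
  TDLC G ->
  type_FPinf [set: G] ->
  cdQ_eq [set: G] n.+1 ->
  weak_lin_isoperimetric [set: G] n ->
  forall H : set G, closed_subgroup H ->
    type_FP H n.+1 -> weak_lin_isoperimetric H n.
Proof.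
move=> tdlc _ [cdG _] [Om [dG [eG [resG [C [C0 isoG]]]]]] H clH [La [dH [eH resH]]].
have clG : closed_subgroup [set: G] by split=> //; exact: closedT.
have [tau tauG] := top_diff_image_splitting tdlc clG resG cdG.
have tau_dom := isoperimetric_splitting_dominated resG tauG C0 isoG.
have resA := perm_aug_resolution resH tdlc clH (@subset_refl _ H).
have resB := perm_aug_resolution resG tdlc clH (@subsetT _ H).
have tauH := image_splittingS (@subsetT _ H) tauG.
have [a [a' [b' [s [[aH a'H b'H sH] da fillH]]]]] :=
  image_splitting_transfer resA resB tauH.
have [properLa _ _ _ _] := resH.
have [_ _ _ finLa] := properLa n (leqnSn n).
have [_ _ _ finLaS] := properLa n.+1 (leqnn _).
apply: (dominated_splitting_isoperimetric resH fillH); apply: dominatedB.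
  apply: dominated_trans (equivariant_dominated finLaS _ b'H) _.
    by apply: equivariant_comp a'H; case: tauH.
  apply: dominated_trans (dominated_comp a' tau_dom) _.
  rewrite (funext da).
  exact: dominated_comp (equivariant_bounded finLa aH).
exact: dominated_comp (equivariant_bounded finLa sH).
Qed.
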